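(* For $n\ge 1$ let $t_n$ be the arbor of size $n$ consisting of a root vertex with one element and $n-1$ child vertices, each a leaf with one element, and let $M_{t_n}(X,Y)$ be the M-triangle of the graded poset $P_{t_n}$. Then, as formal power series in $s$, $$1+\sum_{n\ge1}M_{t_n}(X,Y)\,s^n=\frac{(XYs-Ys-1)(XYs-1)}{(2XYs-Ys-1)(XYs-Ys+s-1)}.$$
   Context: An arbor $t$ of size $n$ is a rooted tree in which each vertex $v$ is decorated by a non-empty subset of $[n]=\{1,\dots,n\}$, these subsets forming a partition of $[n]$. For a vertex $v$, $\mathcal{D}(v)\subseteq[n]$ is the set of all labels occurring in the sub-tree rooted at $v$ (that is, at $v$ and its descendants). The polytope $Q_t\subset\mathbb{R}^n$ is defined by $x_i\ge 0$ for all $i\in[n]$ and $\sum_{i\in\mathcal{D}(v)}x_i\le|\mathcal{D}(v)|$ for every vertex $v$. The poset $P_t$ is the set of lattice points $Q_t\cap\mathbb{Z}^n$ with $x\le y$ iff $x_i\le y_i$ for all $i$; it is graded by the height $\mathrm{ht}(x)=\sum_i x_i$. For the arbor $t_n$ (labelling the root by $\{n\}$ and the leaves by $\{1\},\dots,\{n-1\}$; $t_1$ is a single vertex), the defining inequalities are $x_i\ge0$ for $1\le i\le n$, $x_i\le 1$ for $1\le i\le n-1$, and $x_1+\cdots+x_n\le n$. The M-triangle of $P_t$ is $$M_t(X,Y)=\sum_{a\le b}\mu_{P_t}(a,b)\,X^{\mathrm{ht}(a)}Y^{\mathrm{ht}(b)},$$ the sum being over pairs $a\le b$ in $P_t$,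 where $\mu_{P_t}$ is the Möbius function: $\mu(a,a)=1$ and $\mu(a,b)=-\sum_{a\le e<b}\mu(a,e)$ for $a<b$. *)

(* Defs.v *)
From HB Require Import structures.
From mathcomp Require Import all_boot all_order all_algebra.
From mathcomp Require Import reals.
From mathcomp Require Import mpoly.

Set Implicit Arguments.
Unset Strict Implicit.
Unset Printing Implicit Defensive.

Import Order.TTheory GRing.Theory Num.Theory.
Local Open Scope ring_scope.

(* The ground set [n] = {1, ..., n} is 'I_n, the label i being the ordinal
   i - 1.  A rooted tree is given by its parent function; the root is its own
   parent, and since every vertex reaches the root there are no other cycles.
   The subsets are pairwise distinct and form a partition of [n] in the sense
   of [partition], hence are non-empty and pairwise disjoint. *)
Record arbor (n : nat) := Arbor {
  vertex : finType;
  arbor_root : vertex;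
  parent : vertex -> vertex;
  block : vertex -> {set 'I_n};
  parent_root : parent arbor_root = arbor_root;
  parent_connect : forall v, fconnect parent v arbor_root;
  block_inj : injective block;
  block_partition : partition [set block v | v : vertex] [set: 'I_n]
}.

Definition descendants n (t : arbor n) (v : vertex t) : {set vertex t} :=
  [set w | fconnect (@parent n t) w v].

Definition subtree_labels n (t : arbor n) (v : vertex t) : {set 'I_n} :=
  \bigcup_(w in descendants v) block w.

Definition polytope (R : numDomainType) n (t : arbor n) : {pred 'rV[R]_n} :=
  [pred x : 'rV[R]_n |
    [forall i, 0 <= x 0 i] &&
    [forall v : vertex t,
      \sum_(i in subtree_labels v) x 0 i <= #|subtree_labels v|%:R]].

Arguments polytope R [n] t.

Record lattice_point (R : numDomainType) n (t : arbor n) := LatticePoint {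
  lp_val :> 'rV[int]_n;
  lp_valP : map_mx intr lp_val \in polytope R t
}.

Arguments lattice_point R [n] t.

Section LatticePointTheory.
Variables (R : numDomainType) (n : nat) (t : arbor n).

Lemma subtree_labels_root : subtree_labels (arbor_root t) = [set: 'I_n].
Proof.
apply/setP => i; rewrite inE.
have /and3P[/eqP cov _ _] := block_partition t.
have: i \in cover [set block v | v : vertex t] by rewrite cov inE.
case/bigcupP => B /imsetP[v _ ->] iv.
by apply/bigcupP; exists v => //; rewrite inE parent_connect.
Qed.

Lemma lattice_pointE (x : 'rV[int]_n) :
  (map_mx intr x \in polytope R t) = (x \in polytope int t).
Proof.
rewrite !inE; congr (_ && _); apply: eq_forallb.
  by move=> i; rewrite mxE ler0z.
move=> v; under eq_bigr do rewrite mxE.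
by rewrite -rmorph_sum /= -[#|_|%:R]/((#|subtree_labels v|)%:R : R) -mulrz_nat ler_int natz.
Qed.

HB.instance Definition _ := [isSub for @lp_val R n t].
HB.instance Definition _ := [Choice of lattice_point R t by <:].

Lemma lp_ge0 (x : lattice_point R t) i : 0 <= lp_val x 0 i.
Proof.
by have := lp_valP x; rewrite lattice_pointE => /andP[/forallP/(_ i)].
Qed.

Lemma lp_sum_le (x : lattice_point R t) : \sum_i lp_val x 0 i <= n%:R.
Proof.
have := lp_valP x; rewrite lattice_pointE => /andP[_ /forallP/(_ (arbor_root t))].
rewrite subtree_labels_root cardsT card_ord.
by under eq_bigl do rewrite inE.
Qed.

Lemma lp_le_n (x : lattice_point R t) i : (`|lp_val x 0%R i| <= n)%N.
Proof.
rewrite -lez_nat gez0_abs ?lp_ge0 // -[n%:Z]natz.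
apply: le_trans (lp_sum_le x).
by rewrite (bigD1 i) //= lerDl sumr_ge0 // => j _; apply: lp_ge0.
Qed.

Definition lp_code (x : lattice_point R t) : {ffun 'I_n -> 'I_n.+1} :=
  [ffun i => inord `|lp_val x 0%R i|%N].

Definition lp_decode (f : {ffun 'I_n -> 'I_n.+1}) :
  option (lattice_point R t) := insub (\row_i (f i)%:Z).

Lemma lp_codeK : pcancel lp_code lp_decode.
Proof.
move=> x; rewrite /lp_decode.
have -> : \row_i (lp_code x i)%:Z = val x.
  apply/rowP => i; rewrite mxE ffunE inordK ?ltnS ?lp_le_n //.
  by rewrite gez0_abs ?lp_ge0.
exact: valK.
Qed.

HB.instance Definition _ := PCanIsCountable lp_codeK.
HB.instance Definition _ : isFinite (lattice_point R t) :=
  PCanIsFinite lp_codeK.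

Definition lp_le (x y : lattice_point R t) : bool :=
  [forall i, lp_val x 0 i <= lp_val y 0 i].

Lemma lp_le_refl : reflexive lp_le.
Proof. by move=> x; apply/forallP. Qed.

Lemma lp_le_anti : antisymmetric lp_le.
Proof.
move=> x y /andP[/forallP xy /forallP yx]; apply/val_inj/rowP => i.
by apply/le_anti; rewrite xy yx.
Qed.

Lemma lp_le_trans : transitive lp_le.
Proof.
move=> y x z /forallP xy /forallP yz; apply/forallP => i.
exact: le_trans (xy i) (yz i).
Qed.

HB.instance Definition _ := Order.Le_isPOrder.Build (Order.Disp tt tt)
  (lattice_point R t) lp_le_refl lp_le_anti lp_le_trans.

(* The absolute value is harmless since coordinates are nonnegative; see heightE. *)
Definition height (x : lattice_point R t) : nat := `|(\sum_i lp_val x 0 i)%R|%N.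

Lemma heightE (x : lattice_point R t) : (height x)%:Z = \sum_i lp_val x 0 i.
Proof. by rewrite /height gez0_abs // sumr_ge0 // => i _; apply: lp_ge0. Qed.

End LatticePointTheory.

Definition P_poset (R : numDomainType) n (t : arbor n) :
  finPOrderType (Order.Disp tt tt) := lattice_point R t.

Arguments P_poset R [n] t.

(* The recursion is on a bound for the length of chains; mobiusE below is the
   defining equation. *)
Fixpoint mobius_rec d (T : finPOrderType d) (k : nat) (a b : T) : int :=
  if a == b then 1
  else if k is k'.+1 then
    if (a < b)%O then - \sum_(e : T | (a <= e < b)%O) mobius_rec k' a e else 0
  else 0.

Definition mobius d (T : finPOrderType d) (a b : T) : int :=
  mobius_rec #|T| a b.

Section MobiusTheory.
Variables (d : Order.disp_t) (T : finPOrderType d).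

Lemma mobius_rec_stable k l (a b : T) :
  (#|[set e : T | a <= e < b]%O| <= k)%N ->
  (#|[set e : T | a <= e < b]%O| <= l)%N ->
  mobius_rec k a b = mobius_rec l a b.
Proof.
elim: k l b => [|k IH] l b.
  case: l => [//|l] /=; case: eqP => // _; case: ifP => // ab.
  rewrite leqn0 cards_eq0 => /eqP/setP/(_ a).
  by rewrite !inE lexx ab.
case: l => [|l] /=.
  case: eqP => // _; case: ifP => // ab _.
  rewrite leqn0 cards_eq0 => /eqP/setP/(_ a).
  by rewrite !inE lexx ab.
move=> hk hl; case: eqP => // _; case: ifP => // ab; congr (- _).
apply: eq_bigr => e /andP[ae eb].
have lt_card : (#|[set x : T | a <= x < e]%O| < #|[set x : T | a <= x < b]%O|)%N.
  apply/proper_card/properP; split.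
    apply/subsetP => x; rewrite !inE => /andP[-> xe] /=.
    exact: lt_trans xe eb.
  by exists e; rewrite !inE ?ae ?eb // ltxx andbF.
by apply: IH; rewrite -ltnS; apply: leq_trans lt_card _.
Qed.

Lemma mobius_refl (a : T) : mobius a a = 1.
Proof. by rewrite /mobius; case: #|T| => [|k] /=; rewrite eqxx. Qed.

Lemma mobiusE (a b : T) : (a < b)%O ->
  mobius a b = - \sum_(e : T | (a <= e < b)%O) mobius a e.
Proof.
move=> ab; rewrite {1}/mobius (@mobius_rec_stable #|T| #|T|.+1); last 2 first.
- exact: max_card.
- exact: leq_trans (max_card _) _.
by rewrite /= lt_eqF // ab.
Qed.

End MobiusTheory.

Definition varX : {mpoly int[2]} := 'X_0.
Definition varY : {mpoly int[2]} := 'X_1.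

Definition M_triangle (R : numDomainType) n (t : arbor n) : {mpoly int[2]} :=
  \sum_(a : P_poset R t) \sum_(b : P_poset R t | (a <= b)%O)
    (mobius a b)%:MP * varX ^+ height a * varY ^+ height b.

Arguments M_triangle R [n] t.

(* star_arbor m has size n = m.+1: vertices are identified with their unique
   label, the root is ord_max (i.e. n) and its children are the leaves
   1, ..., n - 1. *)
Section Star.
Variable m : nat.

Let star_parent (_ : 'I_m.+1) : 'I_m.+1 := ord_max.
Let star_block (v : 'I_m.+1) : {set 'I_m.+1} := [set v].

Lemma star_parent_connect v : fconnect star_parent v ord_max.
Proof. by apply: connect1 => /=. Qed.

Lemma star_block_inj : injective star_block.
Proof. exact: set1_inj. Qed.

Lemma star_block_partition :
  partition [set star_block v | v : 'I_m.+1] [set: 'I_m.+1].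
Proof.
apply/and3P; split.
- apply/eqP/setP => i; rewrite inE; apply/bigcupP; exists [set i].
    exact: imset_f.
  by rewrite inE.
- apply/trivIsetP => A B /imsetP[i _ ->] /imsetP[j _ ->] neq.
  by rewrite disjoints1 inE; apply: contraNneq neq => ->.
- by apply/imsetP => -[i _ /setP/(_ i)]; rewrite !inE eqxx.
Qed.

Definition star_arbor : arbor m.+1 :=
  @Arbor m.+1 'I_m.+1 ord_max star_parent star_block
    erefl star_parent_connect star_block_inj star_block_partition.

Lemma star_subtree_labels (v : 'I_m.+1) :
  @subtree_labels m.+1 star_arbor v =
  if v == ord_max then [set: 'I_m.+1] else [set v].
Proof.
case: eqP => [->|/eqP nv]; first exact: (subtree_labels_root star_arbor).
apply/setP => i; rewrite inE; apply/bigcupP/eqP => [[w] | ->]; last first.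
  by exists v; rewrite !inE ?connect0.
rewrite !inE => /iter_findex + /eqP ->.
case: (findex _ _ _) => [//|k] /= /eqP.
by rewrite /star_parent eq_sym (negPf nv).
Qed.

Lemma in_star_polytope (R : numDomainType) (x : 'rV[R]_m.+1) :
  (x \in polytope R star_arbor) =
  [&& [forall i, 0 <= x 0 i],
      [forall i : 'I_m.+1, (i < m)%N ==> (x 0 i <= 1)] &
      \sum_i x 0 i <= m.+1%:R].
Proof.
rewrite inE; congr (_ && _); apply/forallP/andP => [H|[/forallP H1 H2] v].
  split; last first.
    have := H (arbor_root star_arbor); rewrite star_subtree_labels eqxx.
    by rewrite cardsT card_ord; under eq_bigl do rewrite inE.
  apply/forallP => i; apply/implyP => im; have := H i.
  by rewrite star_subtree_labels -val_eqE /= ltn_eqF // big_set1 cards1.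
rewrite star_subtree_labels; case: eqP => [_|/eqP nv].
  by rewrite cardsT card_ord; under eq_bigl do rewrite inE.
rewrite big_set1 cards1; apply: (implyP (H1 v)).
by rewrite ltn_neqAle -ltnS ltn_ord andbT.
Qed.

End Star.

(* A formal power series is its sequence of coefficients. *)
Definition series (K : Type) := nat -> K.

Definition series_of_poly (K : nzRingType) (p : {poly K}) : series K :=
  fun k => p`_k.

Definition series_mul (K : nzRingType) (f g : series K) : series K :=
  fun k => \sum_(i < k.+1) f i * g (k - i)%N.

(* The first k coefficients of 1 / g, for g with invertible g 0. *)
Fixpoint series_inv_coefs (K : unitRingType) (g : series K) (k : nat) : seq K :=
  if k is k'.+1 then
    let c := series_inv_coefs g k' in
    rcons c (((k' == 0%N)%:R - \sum_(i < k') c`_i * g (k' - i)%N) / g 0%N)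
  else [::].

Definition series_inv (K : unitRingType) (g : series K) : series K :=
  fun k => (series_inv_coefs g k.+1)`_k.

Definition series_div (K : unitRingType) (f g : series K) : series K :=
  series_mul f (series_inv g).

Section SeriesTheory.
Variable K : comUnitRingType.
Implicit Types f g : series K.

Lemma size_series_inv_coefs g k : size (series_inv_coefs g k) = k.
Proof. by elim: k => //= k IH; rewrite size_rcons IH. Qed.

Lemma nth_series_inv_coefs g k i :
  (i < k)%N -> (series_inv_coefs g k)`_i = series_inv g i.
Proof.
elim: k => // k IH; rewrite ltnS leq_eqVlt => /orP[/eqP -> //|ik].
by rewrite /= nth_rcons size_series_inv_coefs ik IH.
Qed.

Lemma series_invE g k : series_inv g k =
  ((k == 0%N)%:R - \sum_(i < k) series_inv g i * g (k - i)%N) / g 0%N.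
Proof.
rewrite {1}/series_inv /= nth_rcons size_series_inv_coefs ltnn eqxx.
by congr ((_ - _) / _); apply: eq_bigr => i _; rewrite nth_series_inv_coefs.
Qed.

Lemma series_invP g k : g 0%N \is a GRing.unit ->
  series_mul (series_inv g) g k = (k == 0%N)%:R.
Proof.
move=> ug; rewrite /series_mul big_ord_recr /= subnn.
by rewrite (series_invE g k) divrK // addrC subrK.
Qed.

Lemma series_mul_trunc N f g k : (k < N)%N ->
  series_mul f g k = ((\poly_(i < N) f i) * (\poly_(i < N) g i))`_k.
Proof.
move=> kN; rewrite coefM; apply: eq_bigr => i _.
by rewrite !coef_poly (leq_ltn_trans (leq_ord i) kN) (leq_ltn_trans (leq_subr _ _) kN).
Qed.

Lemma eq_series_mul f f' g g' :
  f =1 f' -> g =1 g' -> series_mul f g =1 series_mul f' g'.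
Proof. by move=> ff gg k; apply: eq_bigr => i _; rewrite ff gg. Qed.

Lemma series_mulC f g : series_mul f g =1 series_mul g f.
Proof. by move=> k; rewrite !(@series_mul_trunc k.+1) // mulrC. Qed.

Lemma series_mulA f g h :
  series_mul f (series_mul g h) =1 series_mul (series_mul f g) h.
Proof.
move=> k; rewrite !(@series_mul_trunc k.+1) //.
pose tr u : {poly K} := \poly_(i < k.+1) u i.
have trM u v i : (i < k.+1)%N -> (tr (series_mul u v))`_i = (tr u * tr v)`_i.
  by move=> ik; rewrite coef_poly ik (@series_mul_trunc k.+1).
transitivity ((tr f * (tr g * tr h))`_k).
  by rewrite !coefM; apply: eq_bigr => i _; rewrite trM // ltnS leq_subr.
rewrite mulrA !coefM; apply: eq_bigr => i _.
by rewrite trM.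
Qed.

Lemma series_mulr1 f : series_mul f (fun k => (k == 0%N)%:R) =1 f.
Proof.
move=> k; rewrite /series_mul big_ord_recr /= subnn mulr1 big1 ?add0r // => i _.
by rewrite subn_eq0 leqNgt ltn_ord mulr0.
Qed.

(* series_div f g is the quotient f / g in K[[s]]. *)
Lemma series_divP f g h : g 0%N \is a GRing.unit ->
  (h =1 series_div f g) <-> (series_mul h g =1 f).
Proof.
move=> ug; split => H k.
  rewrite (eq_series_mul H (frefl g)) -series_mulA.
  by rewrite (eq_series_mul (frefl f) (fun k => series_invP k ug)) series_mulr1.
rewrite /series_div -(eq_series_mul H (frefl _)) -series_mulA.
rewrite -[LHS]series_mulr1; apply: eq_series_mul => // i.
by rewrite series_mulC series_invP.
Qed.

End SeriesTheory.

(* Main.v *)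
(* [P_t] is a down-set of the product order on N^n, so its intervals are
   products of chains and its Moebius function is a product over the
   coordinates. Summing over the lower end [a] first turns the M-triangle into
   the sum over [b] in [P_t] of the product of the weights [w (b_i)], where
   w(0) = 1 and w(k + 1) = u q^k with u = Y (X - 1) and q = X Y.
   For the star arbor with n = m + 1, a point is a subset of the leaves together
   with a bounded root coordinate, so M_n is the sum over r of
   C(m, r) u^r (w(0) + ... + w(m + 1 - r)). Pascal's rule then gives
   M_{n+1} = (q + u) M_n + (1 + u - q) (1 + u)^(n-1); hence multiplying the
   series by (1 - (q + u) s) (1 - (1 + u) s), which is the denominator, leaves
   the numerator (1 - u s) (1 - q s). *)
Require Import Defs.
From HB Require Import structures.
From mathcomp Require Import all_boot all_order all_algebra.
From mathcomp Require Import reals.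
From mathcomp Require Import mpoly.
From mathcomp Require Import ring.
Local Open Scope ring_scope.

Set Implicit Arguments.
Unset Strict Implicit.
Unset Printing Implicit Defensive.

Import Order.TTheory GRing.Theory Num.Theory.

(** * Natural-number coordinates and sums over boxes *)

Section Coordinates.
Context {R : numDomainType} {n : nat} {t : arbor n}.
Implicit Types a b e : P_poset R t.

Definition coord e (i : 'I_n) : nat := `|lp_val e 0%R i|%N.

Lemma coordE e i : (coord e i)%:Z = lp_val e 0 i.
Proof. by rewrite /coord gez0_abs ?lp_ge0. Qed.

Lemma coord_lt e i : (coord e i < n.+1)%N.
Proof. exact: lp_le_n. Qed.

Lemma lp_codeE e i : lp_code e i = coord e i :> nat.
Proof. by rewrite ffunE inordK ?coord_lt. Qed.

Lemma coord_inj a b : coord a =1 coord b -> a = b.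
Proof. by move=> ab; apply/val_inj/rowP => i; rewrite /= -!coordE ab. Qed.

Lemma le_coord a b : (a <= b)%O = [forall i, (coord a i <= coord b i)%N].
Proof. by apply: eq_forallb => i; rewrite -!coordE. Qed.

Lemma height_coord e : height e = (\sum_i coord e i)%N.
Proof.
apply/eqP; rewrite -eqz_nat heightE -[(\sum_i coord e i)%N%:Z]natz natr_sum.
by apply/eqP/eq_bigr => i _; rewrite natz coordE.
Qed.

(** Lowering coordinates only decreases the sums over subtree labels. *)
Lemma polytope_down (x : 'rV[int]_n) e :
    (forall i, 0 <= x 0 i) -> (forall i, x 0 i <= lp_val e 0 i) ->
  map_mx intr x \in polytope R t.
Proof.
move=> x0 xe; rewrite lattice_pointE; apply/andP; split; first exact/forallP.
apply/forallP => v; have := lp_valP e; rewrite lattice_pointE.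
by case/andP=> _ /forallP/(_ v); apply: le_trans; apply: ler_sum.
Qed.

(** The bound by [b] puts every tuple allowed by [Q] inside the polytope, so the points fill a whole
    box and distributivity applies. *)
Lemma sum_box (K : comPzRingType) (Q : 'I_n -> pred nat) b
    (F : 'I_n -> nat -> K) :
    (forall i j, Q i j -> (j <= coord b i)%N) ->
  \sum_(e : P_poset R t | [forall i, Q i (coord e i)]) \prod_i F i (coord e i)
  = \prod_i \sum_(j < n.+1 | Q i j) F i j.
Proof.
move=> Qb; rewrite bigA_distr_big_dep.
(* The default [b] only makes [dec] total: on the family, decoding succeeds. *)
pose dec (f : {ffun 'I_n -> 'I_n.+1}) : P_poset R t := odflt b (lp_decode R t f).
have decE (f : {ffun 'I_n -> 'I_n.+1}) :
    f \in family (fun i => [pred j : 'I_n.+1 | Q i j]) ->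
    forall i, coord (dec f) i = f i.
  move=> /familyP Qf i; rewrite /dec /lp_decode.
  case: insubP => [e _ eE|/negP[]] /=.
    by rewrite /coord -[lp_val e]/(val e) eE mxE.
  apply: (@polytope_down _ b) => j; rewrite mxE //.
  by rewrite -coordE lez_nat; apply/Qb/Qf.
rewrite (reindex_onto dec (@lp_code R n t)) /=; last first.
  by move=> e _; rewrite /dec lp_codeK.
apply: eq_big => [f|f /andP[/forallP Qf /eqP fE]]; last first.
  by apply: eq_bigr => i _; rewrite -lp_codeE fE.
apply/andP/familyP => [[/forallP Qf /eqP fE] i|/familyP Qf].
  by have := Qf i; rewrite -lp_codeE fE.
split; last by apply/eqP/ffunP => i; apply/val_inj; rewrite /= lp_codeE decE.
by apply/forallP => i; rewrite decE //; move/familyP: Qf => /(_ i).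
Qed.

End Coordinates.

(** * The Moebius function as a product over coordinates *)

Definition chain_mobius (k : nat) : int :=
  match k with 0%N => 1 | 1%N => -1 | _ => 0 end.

(** [chain_mobius k] is the Moebius value of an interval of length [k] in a chain; this is its
    defining recursion. *)
Lemma sum_chain_mobius a b : (a <= b)%N ->
  \sum_(a <= j < b.+1) chain_mobius (j - a) = (a == b)%:R.
Proof.
elim: b => [|b IH]; first by rewrite leqn0 => /eqP ->; rewrite big_nat1.
rewrite leq_eqVlt => /orP[/eqP <-|ab]; first by rewrite big_nat1 subnn eqxx.
rewrite big_nat_recr ?(ltnW ab) // IH // (ltn_eqF ab) subSn //.
have [->|ne] := eqVneq a b; first by rewrite subnn.
(* Here [a < b], so the added term is [chain_mobius] at an argument at least 2, which is zero. *)
rewrite /= add0r; case E: (b - a)%N => //; move: ab.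
by rewrite ltnS leq_eqVlt (negPf ne) -subn_gt0 E.
Qed.

Lemma sum_ord_itv (K : nmodType) (a b n : nat) (F : nat -> K) : (b <= n)%N ->
  \sum_(j < n.+1 | (a <= j <= b)%N) F j = \sum_(a <= j < b.+1) F j.
Proof.
move=> bn; rewrite (@big_nat_widen _ _ _ _ _ n.+1) //.
rewrite (@big_nat_widenl _ _ _ _ 0) // big_mkord.
by apply: eq_bigl => j /=; rewrite andbC ltnS.
Qed.

Section MobiusOfArbor.
Context {R : numDomainType} {n : nat} {t : arbor n}.
Implicit Types a b e : P_poset R t.

(** The interval is a box, so the sum factors; a coordinate where [a] and [b] differ gives a zero
    factor. *)
Lemma sum_prod_chain_mobius a b : (a <= b)%O ->
  \sum_(e : P_poset R t | (a <= e <= b)%O)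
     \prod_i chain_mobius (coord e i - coord a i) = (a == b)%:R.
Proof.
move=> ab; have := ab; rewrite le_coord => /forallP cab.
under eq_bigl => e do
  have -> : (a <= e <= b)%O =
     [forall i, (coord a i <= coord e i <= coord b i)%N] by
   rewrite !le_coord; apply/andP/forallP => [[/forallP ? /forallP ?] i|H];
    [apply/andP | split; apply/forallP => i; have /andP[] := H i].
rewrite (@sum_box _ _ _ _ (fun i j => coord a i <= j <= coord b i)%N b
  (fun i j => chain_mobius (j - coord a i))); last by move=> i j /andP[].
under eq_bigr => i _ do
  rewrite (@sum_ord_itv _ _ _ _ (fun j => chain_mobius (j - coord a i)))
  ?sum_chain_mobius // -1?ltnS ?coord_lt //.
have [->|ne] := eqVneq a b; first by rewrite big1 // => i _; rewrite eqxx.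
have /existsP[i ni] : [exists i, coord a i != coord b i].
  apply: contraNT ne; rewrite negb_exists => /forallP E.
  by apply/eqP/coord_inj => i; apply/eqP; rewrite -[_ == _]negbK.
by rewrite (bigD1 i) //= (negPf ni) mul0r.
Qed.

(** Both sides satisfy the same recursion; induction on the height of [b]. *)
Lemma mobius_coord a b : (a <= b)%O ->
  mobius a b = \prod_i chain_mobius (coord b i - coord a i).
Proof.
have [k] := ubnP (height b); elim: k b => // k IH b hb ab.
have [<-|ne] := eqVneq a b.
  by rewrite mobius_refl big1 // => i _; rewrite subnn.
have ltab : (a < b)%O by rewrite lt_neqAle ne.
rewrite mobiusE //; have := sum_prod_chain_mobius ab; rewrite (negPf ne).
rewrite (bigD1 b) ?ab ?lexx //= => /eqP; rewrite addr_eq0 => /eqP ->.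
congr (- _); apply: eq_big => [e|e /andP[ae eb]].
  by rewrite -andbA; congr (_ && _); rewrite lt_neqAle andbC.
apply: IH => //; rewrite ltnS in hb; apply: leq_trans hb.
rewrite !height_coord.
have := eb; rewrite lt_neqAle le_coord => /andP[neb /forallP ceb].
(* Equal coordinate sums would force equality in every coordinate, so [e < b] makes the height drop
   strictly. *)
have le_sum := @leqif_sum _ xpredT _ _ _ (fun i _ => leqif_eq (ceb i)).
rewrite (ltn_leqif le_sum); apply: contraNN neb => /forallP ceq.
by apply/eqP/coord_inj => i; apply/eqP/ceq.
Qed.

End MobiusOfArbor.

(** * The M-triangle as a sum of products of weights *)

Definition coord_weight (j : nat) : {mpoly int[2]} :=
  if j is j'.+1 then varY ^+ j * (varX ^+ j - varX ^+ j') else 1.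

(** At most the two top terms survive. Multiplied by [varY ^+ b], the result is [coord_weight b]. *)
Lemma sum_chain_mobius_varX b :
  \sum_(0 <= j < b.+1) (chain_mobius (b - j))%:MP * varX ^+ j =
  (if b is b'.+1 then varX ^+ b - varX ^+ b' else 1) :> {mpoly int[2]}.
Proof.
case: b => [|b]; first by rewrite big_nat1 mul1r.
rewrite !big_nat_recr //= subnn subSnn big_nat big1 => [|j /andP[_ jb]].
  by rewrite add0r mpolyCN mulN1r mul1r addrC.
by rewrite subSn ?(ltnW jb) // -(subnSK jb) /= mpolyC0 mul0r.
Qed.

(** For a fixed upper end [b], the lower ends fill a box, and the Moebius value and the powers of
    both variables split over the coordinates. *)
Lemma M_triangle_prod (R : numDomainType) n (t : arbor n) :
  M_triangle R t = \sum_(b : P_poset R t) \prod_i coord_weight (coord b i).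
Proof.
rewrite /M_triangle (exchange_big_dep xpredT) //=; apply: eq_bigr => b _.
transitivity (varY ^+ height b * \sum_(a : P_poset R t | (a <= b)%O)
   \prod_i ((chain_mobius (coord b i - coord a i))%:MP * varX ^+ coord a i)).
  rewrite mulr_sumr; apply: eq_bigr => a ab.
  rewrite mobius_coord // big_split /= rmorph_prod /= -expr_sum -height_coord.
  by rewrite mulrC.
rewrite (eq_bigl _ _ (fun a => le_coord a b)).
rewrite (@sum_box _ _ _ _ (fun i j => j <= coord b i)%N b
  (fun i j => (chain_mobius (coord b i - j))%:MP * varX ^+ j)) //.
rewrite height_coord expr_sum -big_split /=; apply: eq_bigr => i _.
have := @sum_ord_itv _ 0 _ _
  (fun j => (chain_mobius (coord b i - j))%:MP * varX ^+ j) (lp_le_n b i).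
rewrite -/(coord b i) => ->; rewrite sum_chain_mobius_varX.
by case: (coord b i) => [|k] //=; rewrite mulr1.
Qed.

(** * Enumeration of the points of the star arbor *)

Lemma sum_subsets (K : pzRingType) (m : nat) (F : nat -> K) :
  \sum_(S : {set 'I_m}) F #|S| = \sum_(r < m.+1) F r *+ 'C(m, r).
Proof.
have card_lt (S : {set 'I_m}) : (#|S| < m.+1)%N.
  by rewrite ltnS -[leqRHS]card_ord max_card.
rewrite (partition_big (fun S => Ordinal (card_lt S)) xpredT) //=.
apply: eq_bigr => r _; have := card_draws 'I_m r; rewrite card_ord => <-.
rewrite -sumr_const; apply: eq_big => [S|S /eqP <- //].
by rewrite inE.
Qed.

Section StarPoset.
Variables (R : numDomainType) (m : nat).
Implicit Types b : P_poset R (star_arbor m).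

(** Index [ord_max] is the root and [lift ord_max j] a leaf: leaves carry the indicator of [S], the
    root carries [k]. *)
Definition star_row (S : {set 'I_m}) (k : nat) : 'rV[int]_m.+1 :=
  \row_i (oapp (fun j => (j \in S) : nat) k (unlift ord_max i))%:Z.

Lemma star_row_lift S k j : star_row S k 0 (lift ord_max j) = (j \in S)%:Z.
Proof. by rewrite mxE liftK. Qed.

Lemma star_row_max S k : star_row S k 0 ord_max = k%:Z.
Proof. by rewrite mxE unlift_none. Qed.

Lemma widen_ord_lift (j : 'I_m) : widen_ord (leqnSn m) j = lift ord_max j.
Proof. exact/val_inj/esym/lift_max. Qed.

Lemma star_row_polytope S k :
  (map_mx intr (star_row S k) \in polytope R (star_arbor m)) =
  (#|S| + k <= m.+1)%N.
Proof.
rewrite lattice_pointE in_star_polytope.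
have -> : \sum_i star_row S k 0 i = (#|S| + k)%N%:Z.
  rewrite big_ord_recr /= star_row_max PoszD; congr (_ + _).
  under eq_bigr => i _ do rewrite widen_ord_lift star_row_lift.
  rewrite -sum1_card -[RHS]natz natr_sum [RHS]big_mkcond /=.
  by apply: eq_bigr => i _; case: (i \in S).
rewrite natz lez_nat andbA; apply/andb_idl => _; apply/andP; split.
  by apply/forallP => i; rewrite mxE.
apply/forallP => i; apply/implyP => im.
have -> : i = lift ord_max (Ordinal im) by apply/val_inj; rewrite [RHS]lift_max.
by rewrite star_row_lift; case: (_ \in S).
Qed.

Definition star_support b : {set 'I_m} :=
  [set j | coord b (lift ord_max j) == 1%N].

Lemma star_coord_le1 b j : (coord b (lift ord_max j) <= 1)%N.
Proof.
have := lp_valP b; rewrite lattice_pointE in_star_polytope.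
case/and3P => _ /forallP/(_ (lift ord_max j)) + _.
by rewrite lift_max ltn_ord /= -coordE lez_nat.
Qed.

Lemma star_rowK b : star_row (star_support b) (coord b ord_max) = lp_val b.
Proof.
apply/rowP => i; case: (unliftP ord_max i) => [j|] ->.
  rewrite star_row_lift -coordE inE; have := star_coord_le1 b j.
  by case: (coord b _) => [|[|]].
by rewrite star_row_max coordE.
Qed.

(** Points are grouped by support [S]. The root coordinate then runs from 0 to [m + 1 - #|S|], which
    is [(m - #|S|).+2] values; leaves outside [S] contribute [w 0 = 1]. *)
Lemma sum_star (K : comPzRingType) (w : nat -> K) : w 0%N = 1 ->
  \sum_(b : P_poset R (star_arbor m)) \prod_i w (coord b i) =
  \sum_(r < m.+1) (w 1%N ^+ r * \sum_(0 <= k < (m - r).+2) w k) *+ 'C(m, r).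
Proof.
move=> w0; rewrite -(@sum_subsets _ _
  (fun r => w 1%N ^+ r * \sum_(0 <= k < (m - r).+2) w k)).
rewrite (partition_big star_support xpredT) //=; apply: eq_bigr => S _.
have S_le : (#|S| <= m)%N by rewrite -[leqRHS]card_ord max_card.
have fiberP (k : 'I_(m - #|S|).+2) :
    map_mx intr (star_row S k) \in polytope R (star_arbor m).
  by rewrite star_row_polytope -leq_subRL ?(leqW S_le) // subSn // -ltnS.
pose fiber k : P_poset R (star_arbor m) := LatticePoint (fiberP k).
have fiber_max k : coord (fiber k) ord_max = k.
  by rewrite /coord /= star_row_max.
have fiber_support k : star_support (fiber k) = S.
  by apply/setP => j; rewrite inE /coord /= star_row_lift; case: (j \in S).
rewrite big_mkord mulr_sumr.
rewrite (reindex_onto fiber (fun b => inord (coord b ord_max))) /=; last first.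
  move=> b /eqP bS; apply/val_inj; rewrite /= -[RHS]star_rowK bS inordK //.
  have := lp_valP b; rewrite -star_rowK star_row_polytope bS.
  by rewrite -leq_subRL ?(leqW S_le) // subSn.
apply: eq_big => [k|k _].
  by rewrite fiber_support fiber_max inord_val !eqxx.
rewrite big_ord_recr /= fiber_max; congr (_ * _).
under eq_bigr => j _ do rewrite widen_ord_lift.
rewrite -prodr_const [RHS]big_mkcond /=; apply: eq_bigr => j _.
by rewrite /coord /= star_row_lift; case: (j \in S).
Qed.

End StarPoset.

(** * A recurrence from Pascal's rule *)

Section StarRecurrence.
Variable (K : comPzRingType) (u q : K) (w : nat -> K).
Hypotheses (w0 : w 0%N = 1) (wS : forall k, w k.+1 = u * q ^+ k).

Definition star_sum (m : nat) : K :=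
  \sum_(r < m.+1) (u ^+ r * \sum_(0 <= k < (m - r).+2) w k) *+ 'C(m, r).

(** Multiplication by [q] carries [w k.+1] to [w k.+2]; the constant is [w 0 + w 1 - q * w 0]. *)
Lemma weight_sumS k :
  \sum_(0 <= j < k.+2) w j = 1 + u - q + q * \sum_(0 <= j < k.+1) w j.
Proof.
elim: k => [|k IH].
  by rewrite big_nat_recr //= big_nat1 w0 wS expr0; ring.
rewrite [in RHS]big_nat_recr // [LHS]big_nat_recr // IH /= !wS exprS; ring.
Qed.

Lemma star_sum0 : star_sum 0 = 1 + u.
Proof.
by rewrite /star_sum big_ord_recl big_ord0 subn0 bin0 mulr1n mul1r addr0
  big_nat_recr //= big_nat1 w0 wS mulr1.
Qed.

Lemma star_sumS m :
  star_sum m.+1 = (q + u) * star_sum m + (1 + u - q) * (1 + u) ^+ m.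
Proof.
pose W k := \sum_(0 <= j < k.+2) w j.
pose f r := (u ^+ r * W (m.+1 - r)%N) *+ 'C(m, r).
(* Pascal's rule: the terms with the same lower index give [f], whose term at [m + 1] vanishes; the
   others, shifted by one, give [u * star_sum m]. *)
transitivity (\sum_(r < m.+1) f r + u * star_sum m).
  rewrite /star_sum big_ord_recl /=.
  under [X in _ + X = _]eq_bigr => r _ do rewrite /bump binS mulrnDr subSS exprS.
  rewrite big_split /= addrA; congr (_ + _); last first.
    by rewrite mulr_sumr; apply: eq_bigr => r _; rewrite [RHS]mulrnAr mulrA.
  rewrite [RHS]big_ord_recl /f /= !bin0; congr (_ + _).
  rewrite big_ord_recr /= bin_small // mulr0n addr0.
  by apply: eq_bigr => r _; rewrite exprS subSS.
(* The first summand rebuilds [star_sum m], the second the binomial expansion of [(1 + u) ^+ m]. *)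
have fE (r : 'I_m.+1) : f r =
    q * ((u ^+ r * W (m - r)%N) *+ 'C(m, r)) +
    (1 + u - q) * (u ^+ r *+ 'C(m, r)).
  have rm : (r <= m)%N by rewrite -ltnS.
  rewrite /f /W subSn // weight_sumS mulrDr mulrnDl addrC; congr (_ + _).
    by rewrite mulrCA mulrnAr.
  by rewrite mulrC mulrnAr.
rewrite (eq_bigr _ (fun r _ => fE r)) big_split /= -!mulr_sumr.
have <- : (1 + u) ^+ m = \sum_(r < m.+1) u ^+ r *+ 'C(m, r).
  by rewrite exprDn; apply: eq_bigr => r _; rewrite expr1n mul1r.
by rewrite [in RHS]mulrDl [RHS]addrAC.
Qed.

End StarRecurrence.

(** * The generating function *)

Lemma M_triangle_star (R : numDomainType) m :
  M_triangle R (star_arbor m) = star_sum (varY * (varX - 1)) coord_weight m.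
Proof.
by rewrite M_triangle_prod sum_star // /star_sum /coord_weight !expr1 expr0.
Qed.

Lemma coord_weightS k :
  coord_weight k.+1 = varY * (varX - 1) * (varX * varY) ^+ k.
Proof. by rewrite /= !exprS exprMn; ring. Qed.

Lemma coef_quadratic (K : nzRingType) (a b : K) k :
  (a *: 'X^2 - b *: 'X + 1)`_k =
  match k with 0 => 1 | 1 => - b | 2 => a | _ => 0 end.
Proof.
by case: k => [|[|[|k]]]; rewrite !coefE /=
  !(mulr0, mulr1, oppr0, subr0, addr0, add0r).
Qed.

(** Turns multiplication by the denominator into a three-term recurrence, cut short at orders 0 and
    1. *)
Lemma series_mul_quadratic (K : comUnitRingType) (a b : K) (h : series K) n :
  series_mul h (series_of_poly (a *: 'X^2 - b *: 'X + 1)) n =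
  match n with
  | 0 => h 0%N
  | 1 => h 1%N - b * h 0%N
  | k.+2 => h k.+2 - b * h k.+1 + a * h k
  end.
Proof.
rewrite series_mulC /series_mul.
under eq_bigr do rewrite /series_of_poly coef_quadratic.
case: n => [|[|n]]; rewrite !big_ord_recl ?big_ord0 /= ?mul1r ?mulNr ?addr0 //.
rewrite big1 ?addr0 => [|i _]; last by rewrite mul0r.
by rewrite !subSS !subn0 addrA.
Qed.

Theorem theorem2p6 (R : realType) :
  let X : {poly {mpoly int[2]}} := varX%:P in
  let Y : {poly {mpoly int[2]}} := varY%:P in
  let s : {poly {mpoly int[2]}} := 'X in
  (fun n : nat => if n is m.+1 then M_triangle R (star_arbor m) else 1)
  =1 series_div
       (series_of_poly ((X * Y * s - Y * s - 1) * (X * Y * s - 1)))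
       (series_of_poly ((2%:R * X * Y * s - Y * s - 1) *
                        (X * Y * s - Y * s + s - 1))).
Proof.
move=> X Y s.
pose q := varX * varY; pose u := varY * (varX - 1).
have -> : (X * Y * s - Y * s - 1) * (X * Y * s - 1) =
    (u * q) *: 'X^2 - (u + q) *: s + 1.
  rewrite -!mul_polyC /u /q /X /Y /s.
  rewrite !(polyCM, polyCD, polyCB, polyCN) polyC1 -/X -/Y; ring.
have -> : (2%:R * X * Y * s - Y * s - 1) * (X * Y * s - Y * s + s - 1) =
    ((q + u) * (1 + u)) *: 'X^2 - (q + u + (1 + u)) *: s + 1.
  rewrite -!mul_polyC /u /q /X /Y /s.
  rewrite !(polyCM, polyCD, polyCB, polyCN) polyC1 -/X -/Y; ring.
apply/series_divP => [|n].
  by rewrite /series_of_poly coef_quadratic unitr1.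
rewrite series_mul_quadratic /series_of_poly coef_quadratic.
have star0 := star_sum0 (erefl : coord_weight 0 = 1) coord_weightS.
have starS := star_sumS (erefl : coord_weight 0 = 1) coord_weightS.
rewrite -/u -/q in star0 starS.
(* Orders 1 and 2 stand apart because they involve the constant coefficient 1, which is not a
   [star_sum]; from order 3 on, the recurrence makes the combination vanish. *)
case: n => [//|[|[|n]]]; rewrite !M_triangle_star -/u
  ?starS ?star0 ?exprS ?expr0; ring.
Qed.
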